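(* Let $G=(X\,\dot\cup\,Y,E)$ be a finite bipartite graph and let $\mathcal{P}_X$ and $\mathcal{P}_Y$ be partitions of $X$ and $Y$, respectively, such that for all $i\in X$ there is a $J\in\mathcal{P}_Y$ with $N(i)\subseteq J$, and for all $j\in Y$ there is an $I\in\mathcal{P}_X$ with $N(j)\subseteq I$. Let $$Q_{\mathcal{P}_{XY}}(G):=\operatorname{conv}\Big\{(x,y,z)\in\{0,1\}^{X\cup Y\cup E}:\ \sum_{i\in I}x_i=1\ (I\in\mathcal{P}_X),\ \sum_{j\in J}y_j=1\ (J\in\mathcal{P}_Y),\ z_{ij}\le x_i,\ z_{ij}\le y_j\ (\{i,j\}\in E,\ i\in X,\ j\in Y),\ \sum_{e\in E}z_e\ge 1\Big\}.$$ Then $Q_{\mathcal{P}_{XY}}(G)$ equals the set of all $(x,y,z)\in[0,1]^{X\cup Y\cup E}$ satisfying $$\sum_{i\in I}x_i=1\ (I\in\mathcal{P}_X),\quad \sum_{j\in J}y_j=1\ (J\in\mathcal{P}_Y),\quad \sum_{e\in E}z_e\ge 1,$$ $$\sum_{j\in N(i)}z_{ij}\le x_i\ (i\in X),\qquad \sum_{i\in N(j)}z_{ij}\le y_j\ (j\in Y).$$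
   Context: $N(v)$ denotes the set of neighbors of $v$ in $G$. Vectors in $\mathbb{R}^{X\cup Y\cup E}$ are written $(x,y,z)$ with $x$ indexed by $X$, $y$ by $Y$, and $z$ by $E$, where $z_{ij}$ is the coordinate of the edge $\{i,j\}$ with $i\in X$, $j\in Y$. *)

(* Defs.v *)
From mathcomp Require Import all_boot all_order all_algebra.
From mathcomp Require Import boolp classical_sets reals convex.
Set Implicit Arguments.
Unset Strict Implicit.
Unset Printing Implicit Defensive.
Import Order.TTheory GRing.Theory Num.Theory.
Local Open Scope classical_set_scope.
Local Open Scope ring_scope.

(* A bipartite graph with colour classes X and Y is given by its edge set      *)
(* E : {set X * Y}, the pair (i, j) standing for the edge {i, j}.              *)

Definition nbrX (X Y : finType) (E : {set X * Y}) (i : X) : {set Y} :=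
  [set j | (i, j) \in E]%SET.
Definition nbrY (X Y : finType) (E : {set X * Y}) (j : Y) : {set X} :=
  [set i | (i, j) \in E]%SET.

(* The index set of R^(X u Y u E): one coordinate per vertex and per edge.     *)
Definition coordXYE (X Y : finType) (E : {set X * Y}) : finType :=
  (X + Y + {e : X * Y | e \in E})%type.

Notation vec R E := {ffun coordXYE E -> R^o}.

Definition xc (R : realType) (X Y : finType) (E : {set X * Y})
  (v : vec R E) (i : X) : R := v (inl (inl i)).
Definition yc (R : realType) (X Y : finType) (E : {set X * Y})
  (v : vec R E) (j : Y) : R := v (inl (inr j)).
Definition zc (R : realType) (X Y : finType) (E : {set X * Y})
  (v : vec R E) (e : {e : X * Y | e \in E}) : R := v (inr e).

(* z_ij, the coordinate of the edge {i, j}; the default value 0 on non-edges   *)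
(* makes the function total and is only junk.                                  *)
Definition zij (R : realType) (X Y : finType) (E : {set X * Y})
  (v : vec R E) (i : X) (j : Y) : R :=
  if insub (i, j) is Some e then zc v e else 0.

Definition conv_hull (R : realType) (M : lmodType R) (A : set M) : set M :=
  smallest (@convex_set R M) A.

Definition Qpoints (R : realType) (X Y : finType) (E : {set X * Y})
  (PX : {set {set X}}) (PY : {set {set Y}}) : set (vec R E) :=
  [set v : vec R E | [/\ forall t : coordXYE E, v t = 0 \/ v t = 1,
              forall I, I \in PX -> \sum_(i in I) xc v i = 1,
              forall J, J \in PY -> \sum_(j in J) yc v j = 1,
              forall i j, (i, j) \in E ->
                zij v i j <= xc v i /\ zij v i j <= yc v j
            & 1 <= \sum_e zc v e]].
Arguments Qpoints R {X Y} E PX PY _.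

Definition Qpoly (R : realType) (X Y : finType) (E : {set X * Y})
  (PX : {set {set X}}) (PY : {set {set Y}}) : set (vec R E) :=
  conv_hull (Qpoints R E PX PY).
Arguments Qpoly R {X Y} E PX PY _.

(* Main.v *)
Require Import Defs.
From mathcomp Require Import all_boot all_order all_algebra.
From mathcomp Require Import boolp classical_sets reals convex interval_inference.
From mathcomp Require Import zify ring lra.
Set Implicit Arguments.
Unset Strict Implicit.
Unset Printing Implicit Defensive.
Import Order.TTheory GRing.Theory Num.Theory.
Local Open Scope classical_set_scope.
Local Open Scope ring_scope.

(** The easy inclusion: for 0/1 points, [N(i)] lies in one block of [Y], in
    which a single [y_j] equals [1]; hence at most one [z_ij] with [j] in [N(i)]
    is nonzero, and it is bounded by [x_i] ([star_sum_le]).  The right-hand side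
    is convex, so it contains the hull.

    The other inclusion says that the right-hand side is an integral polytope.
    Introduce the slacks [s_i = x_i - sum_j z_ij], [t_j = y_j - sum_i z_ij] and
    [w = sum_e z_e - 1].  Eliminating [x] and [y], the block equations become
    the equations of a transportation problem on a bipartite multigraph whose
    left nodes are the blocks of [X] and a dummy, whose right nodes are the
    blocks of [Y] and a dummy: [z_ij] joins the block of [i] to the block of
    [j], [s_i] joins the block of [i] to the right dummy, [t_j] joins the left
    dummy to the block of [j], and [w] joins the two dummies.  The blocks have
    supply and demand [1]; the dummies have [#|PY| - 1] and [#|PX| - 1], and it
    is this supply that encodes [sum_e z_e >= 1], as nonnegativity of [w].

    Transportation problems with integral data are integral
    ([transport_integral]).  In a feasible point, a node that meets a
    non-integral arc meets at least two of them, so the non-integral arcs are at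
    least as many as the nodes that they touch; one node equation is redundant,
    so a nonzero circulation lives on these arcs ([circulation_exists]).  Moving
    along it and along its opposite until some arc becomes integral writes the
    point as a convex combination of two feasible points with fewer non-integral
    arcs ([push_to_integer]).  Finally the linear change of variables
    [of_slacks] sends integral feasible points to the 0/1 points that span the
    left-hand side ([of_slacks_Qpoints]). *)

(** * Convex hulls *)

Lemma convex_setP (R : realType) (M : lmodType R) (A : set M) :
  @convex_set R M A <->
  forall x y (t : R), 0 <= t <= 1 -> A x -> A y -> A (t *: x + (1 - t) *: y).
Proof.
split=> [cA x y t /andP[t0 t1] Ax Ay|cA x y l xA yA].
  by have := cA x y (Itv01 t0 t1) (mem_set Ax) (mem_set Ay); exact: set_mem.
apply: mem_set; apply: cA; [|exact: set_mem xA|exact: set_mem yA].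
by apply/andP; split; [exact: ge0|exact: le1].
Qed.

Lemma conv_hull_convex (R : realType) (M : lmodType R) (A : set M) x y (t : R) :
  0 <= t <= 1 -> conv_hull A x -> conv_hull A y ->
  conv_hull A (t *: x + (1 - t) *: y).
Proof.
move=> t01 hx hy C [cC AC]; have /convex_setP cC' := cC.
by apply: cC' t01 (hx C _) (hy C _); split.
Qed.

Lemma conv_hull_linear (R : realType) (M N : lmodType R) (phi : M -> N)
    (A : set M) (B : set N) :
  (forall (t : R) x y, phi (t *: x + (1 - t) *: y) =
    t *: phi x + (1 - t) *: phi y) ->
  (forall x, A x -> B (phi x)) -> forall x, conv_hull A x -> conv_hull B (phi x).
Proof.
move=> phiL AB x /(_ [set z | conv_hull B (phi z)]); apply; split.
  apply/convex_setP => y z t t01 /= hy hz.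
  by rewrite phiL; exact: conv_hull_convex.
by move=> y Ay; apply: sub_gen_smallest; exact: AB.
Qed.

(** * Integrality of the transportation problem *)

Lemma homogeneous_solution (K : fieldType) (A B : finType) (S : {set A})
    (T : {set B}) (M : A -> B -> K) :
  (#|T| < #|S|)%N ->
  exists d : A -> K, [/\ exists a, d a != 0, forall a, d a != 0 -> a \in S
    & forall b, b \in T -> \sum_a d a * M a b = 0].
Proof.
move=> ltTS.
pose N := \matrix_(i < #|S|, j < #|T|) M (enum_val i) (enum_val j).
have : kermx N != 0.
  rewrite -mxrank_eq0 mxrank_ker subn_eq0 -ltnNge.
  exact: leq_ltn_trans (rank_leq_col _) ltTS.
case/rowV0Pn => u /sub_kermxP uN; case/rV0Pn => k uk0.
pose d a := \sum_(i | enum_val i == a) u 0 i.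
have dE i : d (enum_val i) = u 0 i.
  rewrite /d (big_pred1 i) // => j; exact: (inj_eq enum_val_inj).
have dS a : d a != 0 -> a \in S.
  apply: contraR => aS; apply/eqP/big_pred0 => i; apply/eqP => ia.
  by move: aS; rewrite -ia enum_valP.
exists d; split=> //; first by exists (enum_val k); rewrite dE.
move=> b bT; rewrite (bigID (mem S)) /= addrC big1 ?add0r; last first.
  by move=> a aS; rewrite (contraNeq (@dS a) aS) mul0r.
rewrite big_enum_val /=.
have := congr1 (fun w : 'rV_ _ => w 0 (enum_rank_in bT b)) uN.
rewrite !mxE; apply: etrans; apply: eq_bigr => i _.
by rewrite !mxE enum_rankK_in // dE.
Qed.

(** Every nonempty fibre of [l] on [S] has at least two elements. *)
Lemma double_card_imset_le (A L : finType) (l : A -> L) (S : {set A}) :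
  (forall a, a \in S -> exists b, [/\ b \in S, b != a & l b = l a]) ->
  (#|l @: S|.*2 <= #|S|)%N.
Proof.
move=> mate; rewrite -[#|S|]sum1_card (partition_big_imset l) /=.
rewrite -muln2 -sum_nat_const; apply: leq_sum => _ /imsetP[a aS ->].
have [b [bS ba lba]] := mate a aS.
rewrite (bigD1 a) ?aS ?eqxx //= (bigD1 b) ?bS ?ba ?lba ?eqxx //=.
Qed.

Section Transportation.
Variables (R : realType) (A L T : finType) (l : A -> L) (r : A -> T).
Implicit Types f g : {ffun A -> R^o}.

(** There are at most [#|S| / 2] touched nodes on each side.  The equation at the
    node [l a0] follows from the others, because the left equations and the
    right equations both add up to the total of [d]; without it there are fewer
    equations than unknowns. *)
Lemma circulation_exists (S : {set A}) : S != finset.set0 ->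
  (forall a, a \in S -> exists b, [/\ b \in S, b != a & l b = l a]) ->
  (forall a, a \in S -> exists b, [/\ b \in S, b != a & r b = r a]) ->
  exists d : {ffun A -> R^o}, [/\ exists a, d a != 0,
    forall a, d a != 0 -> a \in S,
    forall u, \sum_(a | l a == u) d a = 0
  & forall w, \sum_(a | r a == w) d a = 0].
Proof.
case/set0Pn => a0 a0S mateL mateR.
(* The touched nodes, without the one whose equation is redundant. *)
pose nodes := (inl @: (l @: S :\ l a0) :|: inr @: (r @: S))%SET : {set L + T}.
pose M (a : A) (n : L + T) : R := match n with
  inl u => (l a == u)%:R | inr w => (r a == w)%:R end.
have ltS : (#|nodes| < #|S|)%N.
  have := double_card_imset_le mateL; have := double_card_imset_le mateR.
  rewrite (cardsD1 (l a0) (l @: S)) imset_f //= => leR leL.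
  apply: leq_ltn_trans (leq_card_setU _ _) _.
  rewrite (card_imset _ inl_inj) (card_imset _ inr_inj).
  rewrite -leq_double doubleS doubleD.
  move: leR leL; rewrite add1n doubleS -!addnn; lia.
have [d [dn0 dS dM]] := homogeneous_solution M ltS.
have ML u : \sum_a d a * M a (inl u) = \sum_(a | l a == u) d a.
  rewrite [RHS]big_mkcond; apply: eq_bigr => a _ /=.
  by case: eqP; rewrite (mulr1, mulr0).
have MR w : \sum_a d a * M a (inr w) = \sum_(a | r a == w) d a.
  rewrite [RHS]big_mkcond; apply: eq_bigr => a _ /=.
  by case: eqP; rewrite (mulr1, mulr0).
have zL u : u \notin l @: S -> \sum_(a | l a == u) d a = 0.
  move=> uS; apply: big1 => a /eqP la; apply: contraNeq uS => /dS aS.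
  by rewrite -la imset_f.
have zR w : \sum_(a | r a == w) d a = 0.
  have [wS|wS] := boolP (w \in r @: S).
    by rewrite -MR dM // inE (imset_f inr wS) orbT.
  apply: big1 => a /eqP ra; apply: contraNeq wS => /dS aS.
  by rewrite -ra imset_f.
have zL' u : u != l a0 -> \sum_(a | l a == u) d a = 0.
  move=> ua0; have [uS|/zL //] := boolP (u \in l @: S).
  by rewrite -ML dM // inE imset_f // !inE ua0 uS.
exists (finfun d); split.
- by have [a da] := dn0; exists a; rewrite ffunE.
- by move=> a; rewrite ffunE; exact: dS.
- move=> u; under eq_bigr do rewrite ffunE.
  have [->|/zL' //] := eqVneq u (l a0).
  have : \sum_a d a = 0.
    by rewrite (partition_big r predT) //= big1.
  by rewrite (partition_big l predT) //= (bigD1 (l a0)) //= [X in _ + X]big1 ?addr0.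
- by move=> w; under eq_bigr do rewrite ffunE; exact: zR.
Qed.

(** A sum with exactly one non-integral term is not an integer. *)
Lemma fractional_mate (P : pred A) f a :
  \sum_(b | P b) f b \is a Num.int -> P a -> f a \isn't a Num.int ->
  exists b, [/\ f b \isn't a Num.int, b != a & P b].
Proof.
move=> sumZ Pa /negP faZ.
have [/existsP[b /and3P[? ? ?]]|] :=
  boolP [exists b, [&& f b \isn't a Num.int, b != a & P b]]; first by exists b.
rewrite negb_exists => /forallP noneb; exfalso; apply: faZ.
move: sumZ; rewrite (bigD1 a) //= rpredDr // rpred_sum // => b /andP[Pb ba].
by have := noneb b; rewrite Pb ba /= andbT negbK.
Qed.

(** The first time at which a moving coordinate reaches an integer.  No
    coordinate crosses an integer before, in particular none crosses [0]. *)
Lemma push_to_integer f (d : {ffun A -> R^o}) :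
  (exists a, d a != 0) -> (forall a, d a != 0 -> f a \isn't a Num.int) ->
  exists2 e : R, 0 < e &
    (exists a, f a \isn't a Num.int /\ f a + e * d a \is a Num.int) /\
    (forall a, 0 <= f a -> 0 <= f a + e * d a).
Proof.
move=> [a0 da0] dfrac.
(* The target is the floor plus one when moving up, the floor when moving down. *)
pose step a : R := ((Num.floor (f a) + (0 < d a)%R)%:~R - f a) / d a.
have step_gt0 a : d a != 0 -> 0 < step a.
  move=> da; have := dfrac a da; rewrite intrEfloor => fl.
  have /andP[lo hi] := floor_itv (f a).
  rewrite /step; have [dp|dn] := boolP (0 < d a).
    by rewrite divr_gt0 // subr_gt0.
  have {}dn : d a < 0 by rewrite lt_neqAle da leNgt.
  by rewrite addr0 nmulr_lgt0 ?invr_lt0 // subr_lt0 lt_neqAle fl lo.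
case: (@arg_minP _ _ _ a0 (fun a => d a != 0) step da0) => a da mina.
exists (step a); first exact: step_gt0.
split.
  exists a; split; first exact: dfrac.
  by rewrite /step divfK // addrC subrK intr_int.
move=> b fb; have [db|db|->] := ltrgtP (d b) 0; last by rewrite mulr0 addr0.
  have db0 : d b != 0 by rewrite lt_eqF.
  have : step b * d b <= step a * d b.
    by rewrite ler_nM2r // mina.
  rewrite {1}/step divfK // (lt_gtF db) addr0 lerBlDl; apply: le_trans.
  by rewrite ler0z floor_ge0.
by rewrite addr_ge0 // mulr_ge0 // ltW // step_gt0.
Qed.

Definition transport (b : L -> R) (c : T -> R) : set {ffun A -> R^o} :=
  [set f | [/\ forall a, 0 <= f a, forall u, \sum_(a | l a == u) f a = b u
             & forall w, \sum_(a | r a == w) f a = c w]].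

(** Induction on the number of non-integral arcs; [push] is the step in one of
    the two directions of a circulation. *)
Lemma transport_integral (b : L -> R) (c : T -> R) :
  (forall u, b u \is a Num.int) -> (forall w, c w \is a Num.int) ->
  transport b c `<=`
  conv_hull [set g | transport b c g /\ forall a, g a \is a Num.int].
Proof.
move=> bZ cZ f; pose frac g := [set a | (g : {ffun A -> R^o}) a \isn't a Num.int]%SET.
have [n] := ubnP #|frac f|; elim: n f => // n IHn f ltn tf.
have [f0 fL fR] := tf.
have [fr0|fr0] := eqVneq (frac f) finset.set0.
  apply: sub_gen_smallest; split=> // a.
  by move/setP/(_ a): fr0; rewrite !inE => /negbFE.
have [a|a|d [dn0 dfrac dL dR]] := circulation_exists fr0.
- rewrite inE => fa; have sZ : \sum_(a' | l a' == l a) f a' \is a Num.int by rewrite fL.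
  have [a' [fa' aa' /eqP la']] := fractional_mate sZ (eqxx _) fa.
  by exists a'; rewrite inE.
- rewrite inE => fa; have sZ : \sum_(a' | r a' == r a) f a' \is a Num.int by rewrite fR.
  have [a' [fa' aa' /eqP ra']] := fractional_mate sZ (eqxx _) fa.
  by exists a'; rewrite inE.
have push (h : {ffun A -> R^o}) : (exists a, h a != 0) ->
    (forall a, h a != 0 -> a \in frac f) ->
    (forall u, \sum_(a | l a == u) h a = 0) ->
    (forall w, \sum_(a | r a == w) h a = 0) ->
    exists2 e : R, 0 < e & conv_hull
      [set g | transport b c g /\ forall a, g a \is a Num.int] (f + e *: h).
  move=> hn0 hfrac hL hR.
  have hfrac' a : h a != 0 -> f a \isn't a Num.int by move/hfrac; rewrite inE.
  have [e e0 [[a1 [fa1 fha1]] ge0]] := push_to_integer hn0 hfrac'.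
  have fhE a : (f + e *: h) a = f a + e * h a by rewrite !ffunE.
  have sumE (P : pred A) : \sum_(a | P a) h a = 0 ->
      \sum_(a | P a) (f + e *: h) a = \sum_(a | P a) f a.
    move=> h0; under eq_bigr do rewrite fhE.
    by rewrite big_split /= -mulr_sumr h0 mulr0 addr0.
  exists e => //; apply: IHn.
    rewrite -ltnS; apply: leq_trans ltn; rewrite ltnS; apply: proper_card.
    rewrite properE; apply/andP; split.
      apply/fintype.subsetP => a; rewrite !inE fhE; apply: contra => fa.
      have [->|/hfrac'] := eqVneq (h a) 0; first by rewrite mulr0 addr0.
      by rewrite fa.
    by apply/fintype.subsetPn; exists a1; rewrite inE // fhE fha1.
  split=> [a|u|w]; first by rewrite fhE; exact: ge0.
    by rewrite sumE.
  by rewrite sumE.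
have [e e0 he] := push d dn0 dfrac dL dR.
have [||||e' e'0 he'] := push (- d).
- by have [a da] := dn0; exists a; rewrite ffunE oppr_eq0.
- by move=> a; rewrite ffunE oppr_eq0; exact: dfrac.
- by move=> u; under eq_bigr do rewrite ffunE; rewrite sumrN dL oppr0.
- by move=> w; under eq_bigr do rewrite ffunE; rewrite sumrN dR oppr0.
have ee' : e + e' != 0 by rewrite gt_eqF // addr_gt0.
have t01 : 0 <= e' / (e + e') <= 1.
  rewrite ler_pdivrMr ?addr_gt0 // mul1r lerDr (ltW e0) andbT.
  by rewrite ltW // divr_gt0 // addr_gt0.
have -> : f = e' / (e + e') *: (f + e *: d) +
            (1 - e' / (e + e')) *: (f + e' *: - d).
  by apply/ffunP => a; rewrite !ffunE /=; rewrite /GRing.scale /=; field.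
exact: conv_hull_convex.
Qed.

End Transportation.

Lemma nat_le1 (R : realType) (x : R) : x \is a Num.nat -> x <= 1 -> x = 0 \/ x = 1.
Proof.
case/natrP => -[|[|n]] -> ; [by left|by right|].
by rewrite (ler_nat R n.+2 1).
Qed.

Lemma pblock_eq (T : finType) (P : {set {set T}}) (I : {set T}) (i : T) :
  finset.partition P [set: T]%SET -> I \in P -> (finset.pblock P i == I) = (i \in I).
Proof.
case/and3P => /eqP cP tP _ IP; apply/eqP/idP => [<-|iI].
  by rewrite finset.mem_pblock cP finset.in_setT.
exact: finset.def_pblock.
Qed.

Lemma in_own_block (T : finType) (P : {set {set T}}) (i : T) :
  finset.partition P [set: T]%SET ->
  finset.pblock P i \in P /\ i \in finset.pblock P i.
Proof.
case/and3P => /eqP cP _ _.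
by rewrite finset.mem_pblock finset.pblock_mem // cP finset.in_setT.
Qed.

Lemma sum_partition1 (R : realType) (T : finType) (P : {set {set T}}) (F : T -> R) :
  finset.partition P [set: T]%SET -> (forall I, I \in P -> \sum_(i in I) F i = 1) ->
  \sum_i F i = #|P|%:R.
Proof.
move=> partP F1; transitivity (\sum_(i in [set: T]%SET) F i).
  by apply: eq_bigl => i; rewrite finset.in_setT.
rewrite (set_partition_big _ partP) /= (eq_bigr (fun=> 1)) //.
by rewrite sumr_const.
Qed.

Lemma sum_block_slack (R : realType) (T K : finType) (P : {set {set T}})
    (I : {set T}) (s : T -> R) (z : K -> R) (p : K -> T) :
  finset.partition P [set: T]%SET -> I \in P ->
  \sum_(i in I) (s i + \sum_(k | p k == i) z k) =
  \sum_(i | finset.pblock P i == I) s i + \sum_(k | finset.pblock P (p k) == I) z k.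
Proof.
move=> partP IP; rewrite big_split /=; congr (_ + _).
  by apply: eq_bigl => i; rewrite pblock_eq.
rewrite [RHS](partition_big p (mem I)) /= => [|k]; last by rewrite pblock_eq.
apply: eq_bigr => i iI; apply: eq_bigl => k; rewrite pblock_eq //.
by case: eqP => [->|]; rewrite ?iI ?andbF.
Qed.

Lemma sumr_comb (R : realType) (I : finType) (P : pred I) (t : R) (F G : I -> R) :
  \sum_(i | P i) (t * F i + (1 - t) * G i) =
  t * \sum_(i | P i) F i + (1 - t) * \sum_(i | P i) G i.
Proof. by rewrite big_split /= -!mulr_sumr. Qed.

(** * Slack variables *)

Section Slacks.
Variables (R : realType) (X Y : finType) (E : {set X * Y}).
Variables (PX : {set {set X}}) (PY : {set {set Y}}).
Implicit Types (v : vec R E) (e : {e : X * Y | e \in E}).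

(** One arc for each slack variable [s_i], [t_j], for each edge variable [z_e],
    and ([inr tt]) for the surplus [w]. *)
Definition arc : finType := (coordXYE E + unit)%type.
Implicit Types g : {ffun arc -> R^o}.

(** [None] is the dummy node. *)
Definition left_node (a : arc) : option {set X} :=
  match a with
  | inl (inl (inl i)) => Some (finset.pblock PX i)
  | inl (inr e) => Some (finset.pblock PX (val e).1)
  | _ => None
  end.
Definition right_node (a : arc) : option {set Y} :=
  match a with
  | inl (inl (inr j)) => Some (finset.pblock PY j)
  | inl (inr e) => Some (finset.pblock PY (val e).2)
  | _ => None
  end.
(** A set that is not a block is an isolated node, so its supply is [0]. *)
Definition left_supply (u : option {set X}) : R :=
  if u is Some B then (B \in PX)%:R else #|PY|%:R - 1.
Definition right_supply (w : option {set Y}) : R :=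
  if w is Some B then (B \in PY)%:R else #|PX|%:R - 1.

Definition degX v i : R := \sum_(e | (val e).1 == i) zc v e.
Definition degY v j : R := \sum_(e | (val e).2 == j) zc v e.

Definition to_slacks v : {ffun arc -> R^o} :=
  [ffun a => match a with
   | inl (inl (inl i)) => xc v i - degX v i
   | inl (inl (inr j)) => yc v j - degY v j
   | inl (inr e) => zc v e
   | inr _ => \sum_e zc v e - 1
   end].

Definition of_slacks g : vec R E :=
  [ffun t => match t with
   | inl (inl i) => g (inl t) + \sum_(e | (val e).1 == i) g (inl (inr e))
   | inl (inr j) => g (inl t) + \sum_(e | (val e).2 == j) g (inl (inr e))
   | inr e => g (inl t)
   end].

Lemma to_slacksK : cancel to_slacks of_slacks.
Proof.
move=> v; apply/ffunP => -[[i|j]|e]; rewrite !ffunE //;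
  by under eq_bigr do rewrite ffunE; rewrite subrK.
Qed.

Lemma of_slacks_comb (t : R) g h :
  of_slacks (t *: g + (1 - t) *: h) = t *: of_slacks g + (1 - t) *: of_slacks h.
Proof.
apply/ffunP => -[[i|j]|e]; rewrite !ffunE //= /GRing.scale /=;
  under eq_bigr do rewrite !ffunE; rewrite sumr_comb; ring.
Qed.

Lemma zc_of_slacks g e : zc (of_slacks g) e = g (inl (inr e)).
Proof. by rewrite /zc ffunE. Qed.

Lemma xc_of_slacks g i :
  xc (of_slacks g) i = g (inl (inl (inl i))) + degX (of_slacks g) i.
Proof.
by rewrite /xc ffunE; congr (_ + _); apply: eq_bigr => e _; rewrite zc_of_slacks.
Qed.

Lemma yc_of_slacks g j :
  yc (of_slacks g) j = g (inl (inl (inr j))) + degY (of_slacks g) j.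
Proof.
by rewrite /yc ffunE; congr (_ + _); apply: eq_bigr => e _; rewrite zc_of_slacks.
Qed.

Lemma zij_edge v i j (ij : (i, j) \in E) : zij v i j = zc v (exist _ (i, j) ij).
Proof. by rewrite /zij insubT. Qed.

Lemma sum_edges v (P : pred (X * Y)) :
  \sum_(e | P (val e)) zc v e = \sum_(p in E | P p) zij v p.1 p.2.
Proof.
rewrite (big_sub_cond (mem E) P (fun p => zij v p.1 p.2)).
by apply: eq_bigr => -[[i j] ij] _; rewrite zij_edge.
Qed.

Lemma degX_nbr v i : \sum_(j in nbrX E i) zij v i j = degX v i.
Proof.
rewrite /degX (sum_edges v (fun p => p.1 == i)).
rewrite (reindex_onto (pair i) snd) /= => [|[i' j] /= /andP[_ /eqP ->] //].
by apply: eq_bigl => j; rewrite inE !eqxx !andbT.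
Qed.

Lemma degY_nbr v j : \sum_(i in nbrY E j) zij v i j = degY v j.
Proof.
rewrite /degY (sum_edges v (fun p => p.2 == j)).
rewrite (reindex_onto (pair^~ j) fst) /= => [|[i j'] /= /andP[_ /eqP ->] //].
by apply: eq_bigl => i; rewrite inE !eqxx !andbT.
Qed.

Hypothesis partX : finset.partition PX [set: X]%SET.
Hypothesis partY : finset.partition PY [set: Y]%SET.

Lemma left_node_sum g I : I \in PX ->
  \sum_(a | left_node a == Some I) g a = \sum_(i in I) xc (of_slacks g) i.
Proof.
move=> IPX; rewrite !big_sumType /= !big_pred0_eq !addr0.
under [RHS]eq_bigr do rewrite xc_of_slacks.
rewrite /degX (sum_block_slack _ _ _ partX IPX); congr (_ + _).
by apply: eq_bigr => e _; rewrite zc_of_slacks.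
Qed.

Lemma right_node_sum g J : J \in PY ->
  \sum_(a | right_node a == Some J) g a = \sum_(j in J) yc (of_slacks g) j.
Proof.
move=> JPY; rewrite !big_sumType /= !big_pred0_eq add0r addr0.
under [RHS]eq_bigr do rewrite yc_of_slacks.
rewrite /degY (sum_block_slack _ _ _ partY JPY); congr (_ + _).
by apply: eq_bigr => e _; rewrite zc_of_slacks.
Qed.

Lemma left_node_sum0 g I : I \notin PX -> \sum_(a | left_node a == Some I) g a = 0.
Proof.
move=> IPX; apply: big_pred0 => -[[[i|j]|e]|[]] //=;
  by apply/eqP => -[] eI; move: IPX; rewrite -eI (in_own_block _ partX).1.
Qed.

Lemma right_node_sum0 g J : J \notin PY -> \sum_(a | right_node a == Some J) g a = 0.
Proof.
move=> JPY; apply: big_pred0 => -[[[i|j]|e]|[]] //=;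
  by apply/eqP => -[] eJ; move: JPY; rewrite -eJ (in_own_block _ partY).1.
Qed.

(** The [t_j] add up to the total of [y] minus the total of [z]. *)
Lemma left_dummy_sum g :
  \sum_(a | left_node a == None) g a =
  \sum_j yc (of_slacks g) j - \sum_e zc (of_slacks g) e + g (inr tt).
Proof.
rewrite !big_sumType /= !big_pred0_eq add0r addr0.
under [in RHS]eq_bigr do rewrite yc_of_slacks.
rewrite big_split /= [X in _ + X - _](_ : _ = \sum_e zc (of_slacks g) e).
  by rewrite addrK; congr (_ + _); rewrite (big_pred1 tt) // => -[].
by rewrite [RHS](partition_big (fun e => (val e).2) predT).
Qed.

Lemma right_dummy_sum g :
  \sum_(a | right_node a == None) g a =
  \sum_i xc (of_slacks g) i - \sum_e zc (of_slacks g) e + g (inr tt).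
Proof.
rewrite !big_sumType /= !big_pred0_eq !addr0.
under [in RHS]eq_bigr do rewrite xc_of_slacks.
rewrite big_split /= [X in _ + X - _](_ : _ = \sum_e zc (of_slacks g) e).
  by rewrite addrK; congr (_ + _); rewrite (big_pred1 tt) // => -[].
by rewrite [RHS](partition_big (fun e => (val e).1) predT).
Qed.

Lemma to_slacks_transport v :
  (forall t, 0 <= v t <= 1) ->
  (forall I, I \in PX -> \sum_(i in I) xc v i = 1) ->
  (forall J, J \in PY -> \sum_(j in J) yc v j = 1) ->
  1 <= \sum_e zc v e ->
  (forall i, degX v i <= xc v i) -> (forall j, degY v j <= yc v j) ->
  transport left_node right_node left_supply right_supply (to_slacks v).
Proof.
move=> v01 v1X v1Y z1 dX dY; split.
- move=> [[[i|j]|e]|[]]; rewrite ffunE ?subr_ge0 //.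
  by have /andP[] := v01 (inr e).
- case=> [I|] /=; last first.
    rewrite left_dummy_sum to_slacksK (sum_partition1 partY v1Y) ffunE.
    by rewrite addrA subrK.
  have [IPX|IPX] := boolP (I \in PX); last exact: left_node_sum0.
  by rewrite left_node_sum // to_slacksK v1X.
- case=> [J|] /=; last first.
    rewrite right_dummy_sum to_slacksK (sum_partition1 partX v1X) ffunE.
    by rewrite addrA subrK.
  have [JPY|JPY] := boolP (J \in PY); last exact: right_node_sum0.
  by rewrite right_node_sum // to_slacksK v1Y.
Qed.

(** The block equations come from the block nodes and bound the natural numbers
    [x_i] and [y_j] by [1].  The left dummy node gives
    [|PY| - sum_e z_e + w = |PY| - 1], hence [sum_e z_e >= 1]. *)
Lemma of_slacks_Qpoints g :
  transport left_node right_node left_supply right_supply g ->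
  (forall a, g a \is a Num.int) -> Qpoints R E PX PY (of_slacks g).
Proof.
case=> g0 gL gR gZ.
have v1X I : I \in PX -> \sum_(i in I) xc (of_slacks g) i = 1.
  by move=> IPX; rewrite -left_node_sum // gL /= IPX.
have v1Y J : J \in PY -> \sum_(j in J) yc (of_slacks g) j = 1.
  by move=> JPY; rewrite -right_node_sum // gR /= JPY.
have gN a : g a \is a Num.nat by rewrite natrEint gZ g0.
have zN e : zc (of_slacks g) e \is a Num.nat by rewrite zc_of_slacks.
have xN i : xc (of_slacks g) i \is a Num.nat.
  by rewrite xc_of_slacks rpredD // rpred_sum.
have yN j : yc (of_slacks g) j \is a Num.nat.
  by rewrite yc_of_slacks rpredD // rpred_sum.
have zx e : zc (of_slacks g) e <= xc (of_slacks g) (val e).1.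
  rewrite xc_of_slacks /degX (bigD1 e) //= addrCA lerDl addr_ge0 // sumr_ge0 //.
  by move=> e' _; rewrite natr_ge0.
have zy e : zc (of_slacks g) e <= yc (of_slacks g) (val e).2.
  rewrite yc_of_slacks /degY (bigD1 e) //= addrCA lerDl addr_ge0 // sumr_ge0 //.
  by move=> e' _; rewrite natr_ge0.
have x1 i : xc (of_slacks g) i <= 1.
  have [IPX iI] := in_own_block i partX.
  rewrite -(v1X _ IPX) (bigD1 i) //= lerDl sumr_ge0 // => i' _.
  by rewrite natr_ge0.
have y1 j : yc (of_slacks g) j <= 1.
  have [JPY jJ] := in_own_block j partY.
  rewrite -(v1Y _ JPY) (bigD1 j) //= lerDl sumr_ge0 // => j' _.
  by rewrite natr_ge0.
split=> //.
- case=> [[i|j]|e].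
  + exact: nat_le1 (xN i) (x1 i).
  + exact: nat_le1 (yN j) (y1 j).
  + exact: nat_le1 (zN e) (le_trans (zx e) (x1 _)).
- by move=> i j ij; rewrite zij_edge; split; [exact: zx|exact: zy].
- have := left_dummy_sum g; rewrite gL /= (sum_partition1 partY v1Y).
  by have := g0 (inr tt); lra.
Qed.

End Slacks.

(** * The description of the hull *)

Lemma zij_comb (R : realType) (X Y : finType) (E : {set X * Y}) (v w : vec R E)
    (t : R) i j :
  zij (t *: v + (1 - t) *: w) i j = t * zij v i j + (1 - t) * zij w i j.
Proof.
by rewrite /zij; case: insubP => [e _ _|_]; rewrite /zc ?ffunE // !mulr0 addr0.
Qed.

(** For [x = 1] the star sum is at most the sum of [y] over the block [J], which
    is [1]. *)
Lemma star_sum_le (R : realType) (T : finType) (N J : {set T}) (x : R)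
    (y z : T -> R) :
  N \subset J -> (forall j, 0 <= y j) -> \sum_(j in J) y j = 1 ->
  (forall j, j \in N -> z j <= x /\ z j <= y j) -> x = 0 \/ x = 1 ->
  \sum_(j in N) z j <= x.
Proof.
move=> NJ y0 y1 zle [xE|xE]; rewrite xE in zle *.
  by apply: sumr_le0 => j /zle[].
rewrite -y1; apply: (@le_trans _ _ (\sum_(j in N) y j)).
  by apply: ler_sum => j /zle[].
rewrite [leRHS](bigID (mem N)) /=.
rewrite [X in _ <= X + _](_ : _ = \sum_(j in N) y j) ?lerDl ?sumr_ge0 //.
by apply: eq_bigl => j; rewrite andb_idl // => /(fintype.subsetP NJ).
Qed.

Theorem theoremB2 (R : realType) (X Y : finType) (E : {set X * Y})
  (PX : {set {set X}}) (PY : {set {set Y}})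
  (partX : finset.partition PX [set: X]%SET) (partY : finset.partition PY [set: Y]%SET)
  (nbrX_block : forall i : X, exists2 J, J \in PY & nbrX E i \subset J)
  (nbrY_block : forall j : Y, exists2 I, I \in PX & nbrY E j \subset I) :
  Qpoly R E PX PY =
  [set v : vec R E |
    (forall t : coordXYE E, 0 <= v t <= 1) /\
    [/\ forall I, I \in PX -> \sum_(i in I) xc v i = 1,
        forall J, J \in PY -> \sum_(j in J) yc v j = 1,
        1 <= \sum_e zc v e,
        forall i : X, \sum_(j in nbrX E i) zij v i j <= xc v i
      & forall j : Y, \sum_(i in nbrY E j) zij v i j <= yc v j]].
Proof.
apply/seteqP; split=> [|v [v01 [v1X v1Y z1 dX dY]]]; last first.
  rewrite -(to_slacksK v).
  pose T := transport (@left_node X Y E PX) (@right_node X Y E PY)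
    (left_supply R PX PY) (right_supply R PX PY).
  apply: (@conv_hull_linear _ _ _ (@of_slacks R X Y E)
    [set g | T g /\ forall a, g a \is a Num.int]).
  - exact: of_slacks_comb.
  - by move=> g [gT gZ]; exact: of_slacks_Qpoints gT gZ.
  apply: (transport_integral (b := left_supply R PX PY)
                             (c := right_supply R PX PY)).
  - by case=> [I|]; [exact: natr_int|exact: rpredB (natr_int _ _) (rpred1 _)].
  - by case=> [J|]; [exact: natr_int|exact: rpredB (natr_int _ _) (rpred1 _)].
  apply: to_slacks_transport => // [i|j].
    by rewrite -degX_nbr.
  by rewrite -degY_nbr.
apply: smallest_sub.
  apply/convex_setP => v w t t01 [v01 [v1X v1Y z1 dX dY]] [w01 [w1X w1Y z1' dX' dY']].
  have /andP[t0 t1] := t01.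
  have comb_le (a a' b b' : R) : a <= a' -> b <= b' ->
      t * a + (1 - t) * b <= t * a' + (1 - t) * b'.
    by move=> aa' bb'; rewrite lerD // ler_wpM2l // subr_ge0.
  have comb1 : t * 1 + (1 - t) * 1 = 1 :> R by ring.
  have combE s : (t *: v + (1 - t) *: w) s = t * v s + (1 - t) * w s by rewrite !ffunE.
  split=> [s|].
    have /andP[v0 v1] := v01 s; have /andP[w0 w1] := w01 s.
    rewrite combE; apply/andP; split; last by rewrite -[leRHS]comb1 comb_le.
    by rewrite addr_ge0 // mulr_ge0 // subr_ge0.
  split=> [I IPX|J JPY||i|j]; rewrite /xc /yc /zc.
  - by under eq_bigr do rewrite combE; rewrite sumr_comb v1X // w1X.
  - by under eq_bigr do rewrite combE; rewrite sumr_comb v1Y // w1Y.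
  - by under eq_bigr do rewrite combE; rewrite sumr_comb -[leLHS]comb1 comb_le.
  - by under eq_bigr do rewrite zij_comb; rewrite sumr_comb combE comb_le // dX.
  - by under eq_bigr do rewrite zij_comb; rewrite sumr_comb combE comb_le // dY.
move=> v [v01 v1X v1Y zle z1].
have v0 t : 0 <= v t <= 1 by case: (v01 t) => ->; rewrite ?lexx ?ler01.
split=> //; split=> // [i|j].
  have [J JPY NJ] := nbrX_block i.
  apply: (star_sum_le (y := yc v) NJ _ (v1Y J JPY)) => [j|j|].
  - by have /andP[] := v0 (inl (inr j)).
  - by rewrite inE => /zle.
  - exact: v01.
have [I IPX NI] := nbrY_block j.
apply: (star_sum_le (y := xc v) NI _ (v1X I IPX)) => [i|i|].
- by have /andP[] := v0 (inl (inl i)).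
- by rewrite inE => /zle[].
- exact: v01.
Qed.
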